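(* If the order $s$ is a positive rational number ($s\in\mathbb Q_+$) or a negative rational number ($s\in\mathbb Q_-$) with $|s|<1$, the fractional derivative of order $s$ (in the sense of the second definition) has the property of linearity $$\frac{d^s(ax^\alpha+bx^\beta)}{dx^s}=a\frac{d^sx^\alpha}{dx^s}+b\frac{d^sx^\beta}{dx^s}.$$
   Context: Second definition. For any $(s,\alpha)\in\mathbb Q\times\mathbb R\setminus\{(-1,-1)\}$ and $x\in\mathbb R^+$, a derivative of order $s$ of the function $ax^\alpha$ (equal to $ae^{\alpha\ln x}$ for $x>0$, and at $x=0$ equal to $a$ if $\alpha=0$ and to $0$ if $\alpha\neq0$) is defined by $$\frac{d^s(ax^\alpha)}{dx^s}=a\frac{d^sx^\alpha}{dx^s}=a\frac{\Gamma(\alpha+1)}{\Gamma(\alpha-s+1)}x^{\alpha-s}+\sum_{k=-|[s]|}^{-1}c_k\frac{x^{k-s}}{\Gamma(k-[s]+1)},$$ and a derivative of order $s$ of the linear combination $ax^\alpha+bx^\beta$ is $$a\frac{\Gamma(\alpha+1)}{\Gamma(\alpha-s+1)}x^{\alpha-s}+b\frac{\Gamma(\beta+1)}{\Gamma(\beta-s+1)}x^{\beta-s}+\sum_{k=-|[s]|}^{-1}c_k\frac{x^{k-s}}{\Gamma(k-[s]+1)}.$$ The $c_k$ are arbitrary constants, $[s]$ is the entire part of $s$ (truncation toward zero, so $[s]=0$ if $|s|<1$), and an empty sum is $0$. Here $\Gamma$ is the gamma function, and $1/\Gamma$ is taken to be $0$ at the poles of $\Gamma$. *)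

(* Defs.v *)
From HB Require Import structures.
From mathcomp Require Import all_boot all_order all_algebra.
From mathcomp Require Import all_classical all_reals all_analysis.

Set Implicit Arguments.
Unset Strict Implicit.
Unset Printing Implicit Defensive.

Import Order.TTheory GRing.Theory Num.Theory.
Import numFieldNormedType.Exports.

Local Open Scope classical_set_scope.
Local Open Scope ring_scope.

(* The poles 0, -1, -2, ... of the gamma function. *)
Definition gamma_pole (R : realType) (x : R) : bool :=
  (x <= 0) && (x \is a Num.int).

(* Euler's integral; it is the gamma function for 0 < x. *)
Definition gamma_integral (R : realType) (x : R) : R :=
  Rintegral (@lebesgue_measure R) `]0, +oo[%classic
    (fun t => t `^ (x - 1) * expR (- t)).

(* For x <= 0, Gamma(x) = Gamma(x + n) / (x (x + 1) ... (x + n - 1)) with n the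
   least natural number such that 0 < x + n. The value at a pole carries no
   meaning and is not used below. *)
Definition Gamma (R : realType) (x : R) : R :=
  if 0 < x then gamma_integral x
  else let n := (Num.truncn (- x)).+1 in
       gamma_integral (x + n%:R) / \prod_(i < n) (x + i%:R).

(* 1 / Gamma, taken to be 0 at the poles of Gamma. *)
Definition rGamma (R : realType) (x : R) : R :=
  if gamma_pole x then 0 else (Gamma x)^-1.

(* The coefficient Gamma(alpha + 1) / Gamma(alpha - s + 1). When alpha + 1 is a
   pole the quotient is read as its limit in alpha, so that for s = 1 and
   alpha = -1 it is -1, as it should be for the derivative of 1 / x. Where that
   limit is infinite the coefficient is an unspecified real number, depending
   on s and alpha only. *)
Definition gamma_quotient (R : realType) (s alpha : R) : R :=
  if gamma_pole (alpha + 1)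
  then lim ((fun t : R => Gamma (t + 1) * rGamma (t - s + 1)) @ alpha^')
  else Gamma (alpha + 1) * rGamma (alpha - s + 1).

(* Truncation toward zero. *)
Definition entire_part (s : rat) : int :=
  if 0 <= s then Num.floor s else Num.ceil s.

(* sum_(k = -|[s]|)^(-1) c_k x^(k - s) / Gamma(k - [s] + 1), with k = -j. *)
Definition complementary_sum (R : realType) (s : rat) (c : int -> R) (x : R)
    : R :=
  \sum_(1 <= j < (`|entire_part s|%N).+1)
    (let k : int := - j%:Z in
     c k * x `^ (k%:~R - ratr s) * rGamma (k - entire_part s + 1)%:~R).

(* The derivative of order s of a x^alpha for the constants c, as a function of
   x >= 0. [powR] has the required values at x = 0: 1 if the exponent is 0, and
   0 otherwise. The couple (s, alpha) = (-1, -1) is outside the domain of the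
   definition. *)
Definition frac_deriv (R : realType) (s : rat) (a alpha : R) (c : int -> R)
    (x : R) : R :=
  a * gamma_quotient (ratr s) alpha * x `^ (alpha - ratr s)
  + complementary_sum s c x.

(* The derivative of order s of a x^alpha + b x^beta for the constants c. *)
Definition frac_deriv_comb (R : realType) (s : rat) (a alpha b beta : R)
    (c : int -> R) (x : R) : R :=
  a * gamma_quotient (ratr s) alpha * x `^ (alpha - ratr s)
  + b * gamma_quotient (ratr s) beta * x `^ (beta - ratr s)
  + complementary_sum s c x.

(* Main.v *)
Require Import Defs.
From mathcomp Require Import all_boot all_order all_algebra.
From mathcomp Require Import all_classical all_reals all_analysis.

Import Order.TTheory GRing.Theory Num.Theory.
Local Open Scope ring_scope.

(** The only obstruction to linearity is the complementary sum: it carries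
    arbitrary constants, which need not match on the two sides. For the orders
    considered it is zero whatever the constants are. If [0 < s] then
    [[s] = floor s >= 0], so each [k - [s] + 1] with [k <= -1] is an integer
    [<= 0], that is, a pole of the gamma function, where [1 / Gamma] vanishes
    ([complementary_sum_ge0]). If [-1 < s <= 0] then [[s] = 0] and the sum is
    empty ([complementary_sum_small]). What is left is linear in the
    coefficients. *)

Lemma rGamma_int_le0 (R : realType) (m : int) :
  m <= 0 -> rGamma (m%:~R : R) = 0.
Proof. by move=> m0; rewrite /rGamma /gamma_pole lerz0 m0 intr_int. Qed.

Lemma complementary_sum_ge0 (R : realType) (s : rat) (c : int -> R) (x : R) :
  0 <= s -> complementary_sum s c x = 0.
Proof.
move=> s0; rewrite /complementary_sum big_nat big1// => j /andP[j1 _] /=.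
rewrite rGamma_int_le0 ?mulr0// /entire_part s0.
have fs0 : 0 <= Num.floor s by rewrite floor_ge0.
have j1z : 1 <= j%:Z by rewrite lez_nat.
by rewrite addrAC subr_le0 (le_trans _ fs0)// addrC subr_le0.
Qed.

Lemma entire_part_small (s : rat) : -1 < s -> s <= 0 -> entire_part s = 0.
Proof.
move=> s1 s0; rewrite /entire_part; case: ifPn => [s_ge0|_].
  by have /eqP -> : s == 0 by [rewrite eq_le s0 s_ge0]; rewrite floor0.
by apply: ceil_def; rewrite s0 sub0r s1.
Qed.

Lemma complementary_sum_small (R : realType) (s : rat) (c : int -> R) (x : R) :
  -1 < s -> s <= 0 -> complementary_sum s c x = 0.
Proof.
by move=> s1 s0; rewrite /complementary_sum entire_part_small// big_geq.
Qed.

(* Each derivative carries its own arbitrary constants. *)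
Theorem theorem4p5 (R : realType) (s : rat)
    (hs : 0 < s \/ (s < 0 /\ `|s| < 1))
    (a b alpha beta : R) (c c1 c2 : int -> R) (x : R) (hx : 0 <= x) :
  frac_deriv_comb s a alpha b beta c x
  = a * frac_deriv s 1 alpha c1 x + b * frac_deriv s 1 beta c2 x.
Proof.
have sum0 d : complementary_sum s d x = 0.
  case: hs => [/ltW|[/ltW s0]]; first exact: complementary_sum_ge0.
  by rewrite ltr_norml => /andP[s1 _]; exact: complementary_sum_small.
by rewrite /frac_deriv_comb /frac_deriv !sum0 !addr0 !mul1r !mulrA.
Qed.
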